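(* For every $n\ge 1$ there exists a bijection $\Upsilon:\mathfrak{S}_n(321)\to\mathfrak{S}_n(213)$ such that for every $\pi\in\mathfrak{S}_n(321)$: (i) for every integer $t\ge 1$, $\pi$ is $t$-stack-sortable if and only if $\Upsilon(\pi)$ is $t$-stack-sortable; (ii) $\mathsf{fix}(\pi)=\mathsf{bad}(\Upsilon(\pi))$ and $\mathsf{drop}(\pi)=\mathsf{des}(\Upsilon(\pi))$. Consequently, for every $t\ge1$, $$\sum_{\pi\in\mathfrak{S}_n^t(321)}r^{\mathsf{fix}(\pi)}x^{\mathsf{drop}(\pi)}=\sum_{\pi\in\mathfrak{S}_n^t(213)}r^{\mathsf{bad}(\pi)}x^{\mathsf{des}(\pi)}.$$
   Context: $\mathfrak{S}_n$ is the set of permutations of $[n]=\{1,\dots,n\}$, written in one-line notation $\pi=\pi_1\cdots\pi_n$. A permutation avoids a pattern $p\in\mathfrak{S}_k$ if it has no subsequence order-isomorphic to $p$; $\mathfrak{S}_n(p)$ denotes the set of $p$-avoiding permutations in $\mathfrak{S}_n$. The stack-sorting map $\mathcal{S}$ is defined recursively on words with distinct letters by $\mathcal{S}(\emptyset)=\emptyset$ and, if $n$ denotes the largest letter of $\pi=\pi_1\cdots\pi_{i-1}\,n\,\pi_{i+1}\cdots\pi_m$, $\mathcal{S}(\pi)=\mathcal{S}(\pi_1\cdots\pi_{i-1})\,\mathcal{S}(\pi_{i+1}\cdots\pi_m)\,n$. A permutation $\pi$ is $t$-stack-sortable if $\mathcal{S}^t(\pi)$ (apply $\mathcal{S}$ $t$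 times) is the identity permutation; $\mathfrak{S}_n^t$ is the set of $t$-stack-sortable permutations in $\mathfrak{S}_n$ and $\mathfrak{S}_n^t(p)=\mathfrak{S}_n^t\cap\mathfrak{S}_n(p)$. For $\pi\in\mathfrak{S}_n$: $\pi_i$ is a descent top if $i<n$ and $\pi_i>\pi_{i+1}$; a drop if $\pi_i<i$; a fixed point if $\pi_i=i$; a right-to-left minimum if $\pi_i<\pi_j$ for all $j>i$; a bad point if $\pi_i$ is a right-to-left minimum and either $i=1$ or $\pi_{i-1}<\pi_i$. $\mathsf{des},\mathsf{drop},\mathsf{fix},\mathsf{bad}$ denote the numbers of descent tops, drops, fixed points, bad points respectively. *)

(* Defs.v *)
From mathcomp Require Import all_boot all_order all_algebra all_fingroup.

Set Implicit Arguments.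
Unset Strict Implicit.
Unset Printing Implicit Defensive.

(* Permutations of [n] are elements of 'S_n, i.e. permutations of {0,..,n-1};
   position and value i of 'I_n stand for i+1. The one-line word is shifted
   back to the letters 1..n. *)
Definition oneline n (s : 'S_n) : seq nat := [seq (s i : nat).+1 | i <- enum 'I_n].

Definition order_iso (u v : seq nat) : bool :=
  (size u == size v) &&
  [forall i : 'I_(size u), forall j : 'I_(size u),
     (nth 0 u i < nth 0 u j) == (nth 0 v i < nth 0 v j)].

(* The subsequences of w are the words mask m w. *)
Definition contains_pattern (p w : seq nat) : bool :=
  [exists m : (size w).-tuple bool, order_iso (mask m w) p].

(* A pattern is given by its one-line word. *)
Definition avoiders n (p : seq nat) : {set 'S_n} :=
  [set s | ~~ contains_pattern p (oneline s)].

Definition p321 : seq nat := [:: 3; 2; 1].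
Definition p213 : seq nat := [:: 2; 1; 3].

Definition largest (w : seq nat) : nat := foldr maxn 0 w.

(* k bounds the recursion depth; any k >= size w gives the same result. *)
Fixpoint stack_sort_rec (k : nat) (w : seq nat) : seq nat :=
  match k, w with
  | k'.+1, _ :: _ =>
      let i := index (largest w) w in
      stack_sort_rec k' (take i w) ++ stack_sort_rec k' (drop i.+1 w)
        ++ [:: largest w]
  | _, _ => [::]
  end.

Definition stack_sort (w : seq nat) : seq nat := stack_sort_rec (size w) w.

Lemma stack_sort_nil : stack_sort [::] = [::].
Proof. by []. Qed.

Lemma largest_in w : w != [::] -> largest w \in w.
Proof.
elim: w => [|a [|b w] IHw] // _; first by rewrite /= maxn0 mem_head.
rewrite [largest _]/= -/(largest (b :: w)) in_cons /maxn.
by case: ifP => _; rewrite ?eqxx ?IHw ?orbT.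
Qed.

Lemma stack_sort_recS k w : w != [::] ->
  stack_sort_rec k.+1 w =
    stack_sort_rec k (take (index (largest w) w) w)
      ++ stack_sort_rec k (drop (index (largest w) w).+1 w) ++ [:: largest w].
Proof. by case: w. Qed.

Lemma stack_sort_rec_fuel k w :
  size w <= k -> stack_sort_rec k w = stack_sort w.
Proof.
have H m k1 k2 w' : size w' <= m -> size w' <= k1 -> size w' <= k2 ->
    stack_sort_rec k1 w' = stack_sort_rec k2 w'.
  elim: m k1 k2 w' => [|m IHm] k1 k2 w'; first by case: w' => //; case: k1; case: k2.
  have [-> _ _ _|w0] := eqVneq w' [::]; first by case: k1; case: k2.
  have Hi : index (largest w') w' < size w' by rewrite index_mem largest_in.
  case: k1 k2 => [|k1] [|k2] Hm H1 H2; try by case: w' w0 {Hi} Hm H1 H2.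
  have Ht p : size w' <= p.+1 -> size (take (index (largest w') w') w') <= p.
    by move=> Hp; rewrite size_take Hi -ltnS (leq_trans Hi).
  have Hd p : size w' <= p.+1 ->
      size (drop (index (largest w') w').+1 w') <= p.
    by move=> Hp; rewrite size_drop leq_subLR addSn (leq_trans Hp) // ltnS leq_addl.
  rewrite !stack_sort_recS //.
  by congr (_ ++ (_ ++ _)); apply: IHm; by [apply: Ht | apply: Hd].
by move=> Hk; apply: (H (size w)).
Qed.

Lemma stack_sort_max (u v : seq nat) (m : nat) :
  all (ltn^~ m) u -> all (ltn^~ m) v ->
  stack_sort (u ++ m :: v) = stack_sort u ++ stack_sort v ++ [:: m].
Proof.
move=> Hu Hv.
have Hl : largest (u ++ m :: v) = m.
  have Hv' : largest v <= m.
    by elim: v Hv => //= a v IHv /andP[Ha /IHv Hv]; rewrite geq_max (ltnW Ha).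
  elim: u Hu => [_|a u IHu /= /andP[Ha /IHu ->]]; first exact/maxn_idPl.
  exact/maxn_idPr/ltnW.
have Hi : index m (u ++ m :: v) = size u.
  rewrite index_cat /= eqxx addn0 ifN //.
  by apply/negP => /(allP Hu); rewrite /= ltnn.
have w0 : u ++ m :: v != [::] by case: (u).
rewrite {1}/stack_sort size_cat /= addnS stack_sort_recS //.
rewrite Hl Hi take_size_cat // -(cat_rcons m u v) drop_size_cat ?size_rcons //.
by congr (_ ++ (_ ++ _)); apply: stack_sort_rec_fuel;
  rewrite ?leq_addl ?leq_addr.
Qed.

Definition stack_sortable (t n : nat) (s : 'S_n) : bool :=
  iter t stack_sort (oneline s) == oneline (1%g : 'S_n).

Definition sortable_avoiders (t n : nat) (p : seq nat) : {set 'S_n} :=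
  [set s | stack_sortable t s] :&: avoiders n p.

(* The statistics count positions i instead of letters s i, which is the same
   since s is injective. *)
Definition des n (s : 'S_n) : nat :=
  #|[set i : 'I_n | [exists j : 'I_n, (j == i.+1 :> nat) && (s j < s i)]]|.

Definition drops n (s : 'S_n) : nat := #|[set i : 'I_n | s i < i]|.

Definition fixpts n (s : 'S_n) : nat := #|[set i : 'I_n | s i == i]|.

Definition rl_min n (s : 'S_n) (i : 'I_n) : bool :=
  [forall j : 'I_n, (i < j) ==> (s i < s j)].

Definition bad n (s : 'S_n) : nat :=
  #|[set i : 'I_n | rl_min s i &&
      ((i == 0 :> nat) || [exists j : 'I_n, (i == j.+1 :> nat) && (s j < s i)])]|.

(* Main.v *)
(* If [b < a] and [a] precedes [b] in [w], then [a] still precedes [b] in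
   [stack_sort w] exactly when some [c > a] lies between them.  Hence, on words
   avoiding 3241 (a property kept by [stack_sort], and shared by 321- and
   213-avoiding permutations), [w] is sorted after [t] passes iff no letter is
   preceded by an increasing sequence of more than [t] larger letters.

   A 321-avoiding [s] is encoded by the path [xcode s j = j - min_(k >= j) s k],
   and a 213-avoiding [u], seen as the preorder word of a plane forest, by
   [wcode u i], the number of nodes weakly above [i] that are not right-to-left
   minima.  Both codes are injective, and each bound and statistic of the
   theorem is read off in the same way from [xcode s i.+1] and [wcode u i], so
   [Upsilon] pairs [s] with the [u] such that [xcode s i.+1 = wcode u i].
   Existence of partners is a Lehmer code construction in one direction and, in
   the other, follows by counting. *)
Require Import Defs.
From mathcomp Require Import all_boot all_order all_algebra all_fingroup.
From mathcomp Require Import zify.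

Set Implicit Arguments.
Unset Strict Implicit.
Unset Printing Implicit Defensive.

(** * Stack sorting of words *)

(** Membership is part of the relation because [index] places an absent letter at the end of the
    word. *)
Definition before (w : seq nat) (a b : nat) : bool :=
  [&& a \in w, b \in w & index a w < index b w].

Lemma before_trans w : transitive (before w).
Proof.
move=> b a c /and3P[aw _ ab] /and3P[_ cw bc].
by rewrite /before aw cw (ltn_trans ab bc).
Qed.

Lemma before_total w a b :
  a \in w -> b \in w -> a != b -> before w a b = ~~ before w b a.
Proof.
move=> aw bw ab; rewrite /before aw bw /= -leqNgt ltn_neqAle.
by rewrite (inj_in_eq (@index_inj _ a w)) ?ab.
Qed.

Lemma before_cat (u v : seq nat) a b : uniq (u ++ v) ->
  before (u ++ v) a b = [|| before u a b, (a \in u) && (b \in v) | before v a b].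
Proof.
rewrite cat_uniq => /and3P[_ /hasPn uv _].
have D x : x \in u -> x \in v = false.
  by move=> xu; apply/negP => /uv /=; rewrite xu.
rewrite /before !mem_cat !index_cat.
have [au|au] := boolP (a \in u); have [bu|bu] := boolP (b \in u);
  rewrite ?(D _ au) ?(D _ bu) ?orbF ?andbF ?andbT //=.
- by move: au; rewrite -index_mem => h; rewrite (leq_trans h) ?leq_addr // andbT.
- move: bu; rewrite -index_mem => h; rewrite ltnNge (leq_trans (ltnW h)) ?leq_addr ?andbF //.
- by rewrite ltn_add2l.
Qed.

(** Induction along the recursion of the sorting map, which cuts a word at its largest letter. *)
Lemma stack_sort_ind (P : seq nat -> Prop) :
  P [::] ->
  (forall u m v, all (ltn^~ m) u -> all (ltn^~ m) v -> uniq (u ++ m :: v) ->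
     P u -> P v -> P (u ++ m :: v)) ->
  forall w, uniq w -> P w.
Proof.
move=> P0 PS w; have [k] := ubnP (size w); elim: k w => // k IHk w.
have [-> //|w0] := eqVneq w [::].
move=> szw uw; have := largest_in w0; set m := largest w => mw.
have lem x : x \in w -> x <= m.
  rewrite /m; elim: (w) => //= y s IHs; rewrite in_cons leq_max.
  by case/predU1P => [->|/IHs ->]; rewrite ?leqnn ?orbT.
move: szw uw lem; case/splitPr: mw => u v szw uw lem.
have [uu uv] : uniq u /\ uniq v.
  by move: uw; rewrite cat_uniq /= => /and4P[-> _ _ ->].
have mu : m \notin u /\ m \notin v.
  by move: uw; rewrite cat_uniq /= negb_or => /and4P[_ /andP[-> _] -> _].
have lt s : {subset s <= u ++ m :: v} -> m \notin s -> all (ltn^~ m) s.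
  move=> sub ms; apply/allP => x xs; rewrite /= ltn_neqAle lem ?sub // andbT.
  by apply: contraNneq ms => <-.
case: mu => mu mv.
move: szw; rewrite size_cat /= addnS ltnS => szw.
apply: PS => //.
- by apply: lt => // x xu; rewrite mem_cat xu.
- by apply: lt => // x xv; rewrite mem_cat in_cons xv !orbT.
- by apply: IHk => //; apply: leq_ltn_trans szw; rewrite leq_addr.
- by apply: IHk => //; apply: leq_ltn_trans szw; rewrite leq_addl.
Qed.

Lemma perm_stack_sort (w : seq nat) : uniq w -> perm_eq (stack_sort w) w.
Proof.
move: w; apply: stack_sort_ind => // u m v ltu ltv _ pu pv.
rewrite stack_sort_max //; apply: perm_cat => //.
by rewrite perm_catC cat1s perm_cons.
Qed.

Lemma mem_stack_sort (w : seq nat) : uniq w -> stack_sort w =i w.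
Proof. by move=> /perm_stack_sort /perm_mem. Qed.

Lemma stack_sort_uniq (w : seq nat) : uniq w -> uniq (stack_sort w).
Proof. by move=> uw; rewrite (perm_uniq (perm_stack_sort uw)). Qed.

Definition separated w a b := exists c, [/\ a < c, before w a c & before w c b].

(** Cut the word at its largest letter [m]. If [b] lies in [u], or [a] lies in [v], then so do the
    other letter and any letter between them, and induction applies. In the remaining case [a] is in
    [u], [b] is in [v], and [m] separates them. *)
Lemma before_stack_sort (w : seq nat) a b : uniq w -> b < a ->
  before (stack_sort w) a b <-> separated w a b.
Proof.
move=> uw ba; move: w uw; apply: stack_sort_ind.
  by split => [|[c []]].
move=> u m v ltu ltv uw IHu IHv.
have [uu uv] : uniq u /\ uniq v.
  by move: uw; rewrite cat_uniq /= => /and4P[-> _ _ ->].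
have us := stack_sort_uniq uw; move: us; rewrite stack_sort_max // => us.
have us2 : uniq (stack_sort v ++ [:: m]) by move: us; rewrite cat_uniq => /and3P[].
have um : uniq ([:: m] ++ v) by move: uw; rewrite cat_uniq => /and3P[].
have bef1 x y : before [:: m] x y = false.
  by rewrite /before /= !inE; apply/negP => /and3P[/eqP-> /eqP->]; rewrite ltnn.
have befw x y : before (u ++ m :: v) x y =
  [|| before u x y, (x \in u) && (y \in m :: v), (x == m) && (y \in v) | before v x y].
  by rewrite before_cat // (before_cat (u := [:: m])) // bef1 mem_seq1.
rewrite before_cat // before_cat // bef1 orbF !mem_cat !inE !mem_stack_sort //.
have ltu' x : x \in u -> x < m by move/(allP ltu).
have ltv' x : x \in v -> x < m by move/(allP ltv).
have D x : x \in u -> x \in v = false.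
  move: uw; rewrite cat_uniq => /and3P[_ /hasPn h _] xu; apply/negP => xv.
  by have := h x; rewrite inE xv orbT /= xu => /(_ isT).
have Dm : (m \in u = false) * (m \in v = false).
  by split; [apply/negP => /ltu' | apply/negP => /ltv']; rewrite ltnn.
have lem x : x \in u ++ m :: v -> x <= m.
  by rewrite mem_cat inE => /or3P[/ltu'/ltnW|/eqP->|/ltv'/ltnW].
split.
- case/or3P => [/IHu[c [ac h1 h2]]|/andP[au /orP[bv|/eqP bm]]|/orP[/IHv[c [ac h1 h2]]|]].
  + by exists c; rewrite !befw h1 h2.
  + exists m; rewrite !befw au bv inE eqxx /= !orbT; split => //.
    exact: ltu'.
  + by have := ltu' _ au; rewrite -bm ltnNge (ltnW ba).
  + by exists c; rewrite !befw h1 h2 !orbT.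
  + by case/andP => /ltv' + /eqP bm; rewrite -bm ltnNge (ltnW ba).
- have befu x y : y \in u -> before (u ++ m :: v) x y -> before u x y.
    move=> yu; rewrite befw; case/or4P => [//|/andP[_]|/andP[_]|/and3P[_]];
      rewrite ?inE (D _ yu) ?orbF //.
    by move=> /eqP ym; rewrite ym Dm in yu.
  have befv x y : x \in v -> before (u ++ m :: v) x y -> before v x y.
    move=> xv; rewrite befw /=; case/or4P => [/and3P[xu]|/andP[xu]|/andP[/eqP xm]|//].
    + by rewrite (D _ xu) in xv.
    + by rewrite (D _ xu) in xv.
    + by rewrite xm Dm in xv.
  case=> c [ac ac' cb]; have /and3P[aw cw _] := ac'; have /and3P[_ bw _] := cb.
  have bm : b != m by apply: contraTneq ba => ->; rewrite -leqNgt lem.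
  have am : a != m by apply: contraTneq ac => ->; rewrite -leqNgt lem.
  move: aw bw; rewrite !mem_cat !inE (negPf am) (negPf bm) /=.
  have [bu _ _|_] := boolP (b \in u).
    have cb' := befu _ _ bu cb; have /and3P[cu _ _] := cb'.
    by apply/or3P/Or31/IHu; exists c; rewrite cb' befu.
  have [av _ _|_] := boolP (a \in v).
    have ac2 := befv _ _ av ac'; have /and3P[_ cv _] := ac2.
    by apply/or3P/Or33/orP; left; apply/IHv; exists c; rewrite ac2 befv.
  by rewrite orbF /= => -> ->; rewrite orbT.
Qed.

Lemma before_mem w a b : before w a b -> (a \in w) /\ (b \in w).
Proof. by case/and3P. Qed.

Definition has3241 w := exists a b c d,
  [/\ before w a b, before w b c, before w c d & [/\ d < b, b < a & a < c]].

Lemma before_unsort (w : seq nat) a b : uniq w -> b < a ->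
  before (stack_sort w) a b -> before w a b.
Proof.
move=> uw ba /(before_stack_sort uw ba)[c [_ ac cb]].
exact: before_trans ac cb.
Qed.

Lemma before_sort (w : seq nat) a b : uniq w -> a < b ->
  before w a b -> before (stack_sort w) a b.
Proof.
move=> uw ab bef; have [aw bw] := before_mem bef.
rewrite before_total ?mem_stack_sort //; last by rewrite neq_ltn ab.
apply/negP => /(before_unsort uw ab).
by move: bef; rewrite before_total ?neq_ltn ?ab // => /negP.
Qed.

(** The inversions [a b] and [c d] are already present in [w]. If [b] precedes [c] there, the same
    letters work. Otherwise some [f > c] separates [c] from [d] in [w]. If [b] precedes [f], then
    [a b f d] is an occurrence; if not, [f] separates [c] from [b], so [c] would still precede [b]
    after the pass. *)
Lemma has3241_stack_sort (w : seq nat) : uniq w -> has3241 (stack_sort w) -> has3241 w.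
Proof.
move=> uw [a [b [c [d [ab bc cd [db ba ac]]]]]].
have [aw bw] := before_mem ab; have [cw dw] := before_mem cd.
rewrite !mem_stack_sort // in aw bw cw dw.
have dc : d < c by rewrite (ltn_trans db) // (ltn_trans ba).
have bc' : b < c by rewrite (ltn_trans ba).
have ab' := before_unsort uw ba ab.
have cd' := before_unsort uw dc cd.
have [bcw|] := boolP (before w b c).
  by exists a, b, c, d.
have cNb : c != b by rewrite neq_ltn bc' orbT.
rewrite -before_total // => cbw.
have /(before_stack_sort uw dc)[f [cf bf fd]] := cd.
have [_ fw] := before_mem bf.
have bNf : b != f by rewrite neq_ltn (ltn_trans bc').
have [bfw|] := boolP (before w b f).
  exists a, b, f, d; split => //; split => //; exact: ltn_trans cf.
rewrite -before_total 1?eq_sym // => fbw.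
have : separated w c b by exists f.
move/(before_stack_sort uw bc').
by rewrite before_total ?mem_stack_sort // bc.
Qed.

Definition rises_over w k := exists cs b,
  [/\ k < size cs, pairwise (fun x y => (x < y) && before w x y) cs
    & all (fun x => (b < x) && before w x b) cs].

(** From left to right, the last letter [l] of the sequence still precedes [b] after the pass, so a
    larger [d] lies between them in [w] and extends the sequence. From right to left, drop the last
    letter: it separates each of the others from [b]. *)
Lemma rises_over_stack_sort (w : seq nat) k : uniq w -> ~ has3241 w ->
  rises_over (stack_sort w) k <-> rises_over w k.+1.
Proof.
move=> uw no3241; split=> [] [cs [b]].
- case/lastP: cs => [|cs l]; first by case.
  rewrite size_rcons !pairwise_rcons !all_rcons /=.
  case=> ks /andP[/allP csl pcs] /andP[/andP[bl lb] /allP csb].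
  have [d [ld ld' db]] := (before_stack_sort uw bl).1 lb.
  (* Suppose [y] precedes [x] in [w], and let [e] separate [y] from [b]. If [x] precedes [e], then
     [y x e b] is a 3241; if [e] precedes [x], then [e] separates [y] from [x], so the pass leaves
     [y] before [x]. *)
  have unsort x y : x < y -> b < x -> before (stack_sort w) x y ->
      before (stack_sort w) x b -> before (stack_sort w) y b -> before w x y.
    move=> xy bx bxy xb yb; have bY := ltn_trans bx xy.
    have [xw yw] := before_mem bxy; rewrite !mem_stack_sort // in xw yw.
    have [//|] := boolP (before w x y).
    rewrite -before_total ?neq_ltn ?xy ?orbT // => yxw; case: no3241.
    have [e [ye ye' eb]] := (before_stack_sort uw bY).1 yb.
    have [_ ew] := before_mem ye'.
    have xNe : x != e by rewrite neq_ltn (ltn_trans xy).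
    suff xe : before w x e by exists y, x, e, b.
    rewrite before_total //; apply/negP => ex.
    have : separated w y x by exists e.
    move/(before_stack_sort uw xy).
    by rewrite before_total ?mem_stack_sort // ?neq_ltn ?xy ?orbT // bxy.
  have csl' x : x \in cs -> before w x l.
    move=> xcs; have /andP[xl xl'] := csl _ xcs; have /andP[bx xb] := csb _ xcs.
    exact: unsort.
  exists (rcons (rcons cs l) d), b.
  rewrite !size_rcons !pairwise_rcons !all_rcons ltnS ks ld ld' db andbT /=.
  rewrite (ltn_trans bl ld) (before_trans ld' db) bl /=; split => //.
  + apply/and3P; split.
    * apply/allP => x xcs /=; rewrite (before_trans (csl' _ xcs) ld') andbT.
      by have /andP[xl _] := csl _ xcs; apply: ltn_trans xl ld.
    * by apply/allP => x xcs /=; rewrite csl' // andbT; have /andP[] := csl _ xcs.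
    * apply: (sub_in_pairwise (P := mem cs)) pcs; last exact/allP.
      move=> x y xcs ycs /andP[xy xy']; rewrite xy /=.
      have /andP[bx xb] := csb _ xcs; have /andP[_ yb] := csb _ ycs.
      exact: unsort.
  + apply/allP => x xcs /=; have /andP[-> _] := csb _ xcs.
    exact: before_trans (csl' _ xcs) (before_trans ld' db).
- case/lastP: cs => [|cs l]; first by case.
  rewrite size_rcons ltnS !pairwise_rcons !all_rcons /=.
  case=> ks /andP[/allP csl pcs] /andP[/andP[bl lb] /allP csb].
  exists cs, b; split => //.
    by apply: sub_pairwise pcs => x y /andP[xy bxy]; rewrite xy before_sort.
  apply/allP => x xcs; have /andP[bx xb] := csb _ xcs; rewrite bx /=.
  apply/(before_stack_sort uw bx); exists l.
  by have /andP[? ?] := csl _ xcs.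
Qed.

(** At bound 0 a single letter over [b] is enough, so the obstruction is an inversion. *)
Lemma sorted_rises_over (w : seq nat) : uniq w -> sorted ltn w <-> ~ rises_over w 0.
Proof.
move=> uw; split=> [sw [[|a cs] [b []]] //= _ _ /andP[/andP[ba /and3P[aw bw ab]] _]|nr].
  by have := sorted_ltn_index ltn_trans sw _ _ aw bw ab; rewrite ltnNge (ltnW ba).
rewrite (sorted_pairwise ltn_trans); apply/(pairwiseP 0) => i j iw jw ij.
rewrite ltn_neqAle nth_uniq // neq_ltn ij /= leqNgt; apply/negP => ji.
apply: nr; exists [:: nth 0 w i], (nth 0 w j); split => //=.
by rewrite ji /before !mem_nth // !index_uniq // ij.
Qed.

Lemma sorted_iter_stack_sort t (w : seq nat) : uniq w -> ~ has3241 w ->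
  sorted ltn (iter t stack_sort w) <-> ~ rises_over w t.
Proof.
elim: t w => [|t IHt] w uw no; first exact: sorted_rises_over.
rewrite iterSr IHt ?stack_sort_uniq //; last by move/has3241_stack_sort; auto.
by rewrite rises_over_stack_sort.
Qed.

(** * One-line words and patterns *)

Section Oneline.

Variable n : nat.
Implicit Type s : 'S_n.

Lemma sorted_enum_ord : pairwise (fun i j : 'I_n => i < j) (enum 'I_n).
Proof.
have := iota_ltn_sorted 0 n; rewrite (sorted_pairwise ltn_trans) -val_enum_ord.
by rewrite pairwise_map.
Qed.

Lemma pairwise_enum_set (A : {set 'I_n}) (r : rel 'I_n) :
  {in A &, forall i j : 'I_n, i < j -> r i j} -> pairwise r (enum A).
Proof.
move=> rA; have sub : subseq (enum A) (enum 'I_n).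
  by rewrite (enumT 'I_n); apply: filter_subseq.
have := subseq_pairwise sub sorted_enum_ord.
by apply: (sub_in_pairwise (P := mem A)) => //; apply/allP => x; rewrite mem_enum.
Qed.

Definition letter s (i : 'I_n) := (s i).+1.

Lemma letter_inj s : injective (letter s).
Proof. by move=> i j [] /val_inj /perm_inj. Qed.

Lemma mem_oneline s i : letter s i \in oneline s.
Proof. by apply: map_f; rewrite mem_enum. Qed.

Lemma onelineP s a : reflect (exists i, a = letter s i) (a \in oneline s).
Proof.
apply: (iffP mapP) => [[i _ ->]|[i ->]]; first by exists i.
by exists i; rewrite ?mem_enum.
Qed.

Lemma oneline_uniq s : uniq (oneline s).
Proof. by rewrite map_inj_uniq ?enum_uniq //; apply: letter_inj. Qed.

Lemma before_oneline s i j : before (oneline s) (letter s i) (letter s j) = (i < j).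
Proof.
rewrite /before !mem_oneline /oneline !(index_map (@letter_inj s)) /=.
by rewrite !index_enum_ord.
Qed.

(** The identity word is the only increasing rearrangement of its letters. *)
Lemma stack_sortableE t s :
  stack_sortable t s = sorted ltn (iter t stack_sort (oneline s)).
Proof.
have perm_iter : perm_eq (iter t stack_sort (oneline s)) (oneline s).
  elim: t => //= t IHt; apply: (perm_trans _ IHt).
  by apply: perm_stack_sort; rewrite (perm_uniq IHt) oneline_uniq.
have sorted1 : sorted ltn (oneline (1%g : 'S_n)).
  rewrite (sorted_pairwise ltn_trans) /oneline pairwise_map.
  by apply: sub_pairwise sorted_enum_ord => i j; rewrite /= !perm1.
apply/eqP/idP => [-> //|sorted_iter].
apply: (irr_sorted_eq ltn_trans ltnn) => // a; rewrite (perm_mem perm_iter).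
apply/onelineP/onelineP => [] [i ->].
  by exists (s i); rewrite /letter perm1.
by exists (s^-1 i)%g; rewrite /letter perm1 permKV.
Qed.

(** A set of positions can replace the list, since enumerating it in increasing order gives the list
    back. *)
Lemma rises_over_oneline t s :
  rises_over (oneline s) t <->
  exists (k : 'I_n) (A : {set 'I_n}),
    [/\ t < #|A|, {in A, forall i : 'I_n, i < k /\ s k < s i}
      & {in A &, forall i j : 'I_n, i < j -> s i < s j}].
Proof.
split=> [[cs [b [tcs pcs csb]]]|[k [A [tA Ak AA]]]].
  have ucs : uniq cs.
    by apply: (@pairwise_uniq _ ltn _ ltnn); apply: sub_pairwise pcs => x y /andP[].
  have bw : b \in oneline s.
    by case: (cs) tcs csb => //= c cs' _ /andP[/andP[_ /before_mem[]]].
  have [k bk] := onelineP _ _ bw.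
  subst b; exists k, [set i | letter s i \in cs]; split.
  - apply: leq_trans tcs _; rewrite cardE -(size_map (letter s)).
    apply: uniq_leq_size ucs _ => c ccs.
    have /andP[_ /before_mem[/onelineP[i ci] _]] := allP csb _ ccs.
    by subst c; rewrite map_f // mem_enum inE.
  - move=> i; rewrite inE => /(allP csb) /andP[].
    by rewrite before_oneline /letter ltnS.
  - move=> i j; rewrite !inE => ics jcs ij.
    have tr : transitive (fun x y => (x < y) && before (oneline s) x y).
      move=> y x z /andP[xy xy'] /andP[yz yz'].
      by rewrite (ltn_trans xy yz) (before_trans xy' yz').
    have := pcs; rewrite -sorted_pairwise // => scs.
    have [lt_ij|lt_ji|eq_ij] := ltngtP (index (letter s i) cs) (index (letter s j) cs).
    + by have /andP[] := sorted_ltn_index tr scs _ _ ics jcs lt_ij.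
    + have /andP[_] := sorted_ltn_index tr scs _ _ jcs ics lt_ji.
      by rewrite before_oneline ltnNge (ltnW ij).
    + by move: ij; rewrite (letter_inj (@index_inj _ 0 cs _ _ ics jcs eq_ij)) ltnn.
- exists (map (letter s) (enum A)), (letter s k); split.
  + by rewrite size_map -cardE.
  + rewrite pairwise_map; apply: pairwise_enum_set => i j iA jA ij /=.
    by rewrite before_oneline ij andbT; apply: AA.
  + apply/allP => c /mapP[i]; rewrite mem_enum => /Ak[ik ki] ->.
    by rewrite before_oneline ik /letter ltnS ki.
Qed.

Lemma order_iso_321 a b c : order_iso [:: a; b; c] p321 = (c < b < a).
Proof.
apply/idP/idP => [/andP[_ /forallP h]|].
  have /eqP := forallP (h (inord 1)) (inord 0).
  have /eqP := forallP (h (inord 2)) (inord 1).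
  by rewrite /= !inordK //= => -> ->.
move=> /andP[cb ba]; apply/andP; split => //.
apply/forallP => -[[|[|[|i]]] hi] //; apply/forallP => -[[|[|[|j]]] hj] //=; lia.
Qed.

Lemma order_iso_213 a b c : order_iso [:: a; b; c] p213 = (b < a < c).
Proof.
apply/idP/idP => [/andP[_ /forallP h]|].
  have /eqP := forallP (h (inord 1)) (inord 0).
  have /eqP := forallP (h (inord 0)) (inord 2).
  by rewrite /= !inordK //= => -> ->.
move=> /andP[cb ba]; apply/andP; split => //.
apply/forallP => -[[|[|[|i]]] hi] //; apply/forallP => -[[|[|[|j]]] hj] //=; lia.
Qed.

Lemma contains_pattern3P s (p : seq nat) : size p = 3 ->
  reflect (exists i j k : 'I_n,
             [/\ i < j, j < k & order_iso [:: letter s i; letter s j; letter s k] p])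
          (contains_pattern p (oneline s)).
Proof.
move=> p3; apply: (iffP existsP) => [[m]|[i [j [k [ij jk iso]]]]].
  rewrite /oneline -map_mask => iso.
  have := pairwise_mask m sorted_enum_ord.
  have : size (mask m (enum 'I_n)) = 3.
    by move/andP: (iso) => [/eqP + _]; rewrite size_map p3.
  move: iso; case: (mask _ _) => [|i [|j [|k [|l r]]]] //= iso _.
  by case/and3P => /and3P[ij _ _] /andP[jk _] _; exists i, j, k.
have : subseq [:: letter s i; letter s j; letter s k] (oneline s).
  have -> : [:: letter s i; letter s j; letter s k] = map (letter s) [:: i; j; k] by [].
  apply: map_subseq; have -> : [:: i; j; k] = filter (mem [:: i; j; k]) (enum 'I_n).
    apply: (@irr_sorted_eq _ (fun i j : 'I_n => i < j)) => /=.
    - by move=> ? ? ?; apply: ltn_trans.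
    - by move=> ?; rewrite ltnn.
    - by rewrite ij jk.
    - apply: sorted_filter; first by move=> ? ? ?; apply: ltn_trans.
      exact/pairwise_sorted/sorted_enum_ord.
    - by move=> x; rewrite mem_filter mem_enum andbT.
  exact: filter_subseq.
case/subseqP => m /eqP sm em; exists (Tuple sm).
by rewrite -em.
Qed.

(** The forbidden comparison is stated positively, as letters at distinct positions differ. *)
Definition avoids_321 s :=
  forall i j k : 'I_n, i < j -> j < k -> s j < s i -> s j < s k.

Definition avoids_213 s :=
  forall i j k : 'I_n, i < j -> j < k -> s j < s i -> s k < s i.

Lemma perm_neq_lt s (i j : 'I_n) : i < j -> s i != s j :> nat.
Proof. by move=> ij; rewrite (inj_eq val_inj) (inj_eq perm_inj) neq_ltn ij. Qed.

Lemma avoiders321P s : reflect (avoids_321 s) (s \in avoiders n p321).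
Proof.
rewrite inE; apply: (iffP idP) => [/(contains_pattern3P _ (erefl : size p321 = 3)) h|h].
  move=> i j k ij jk ji; rewrite ltn_neqAle perm_neq_lt // leqNgt; apply/negP => kj.
  by apply: h; exists i, j, k; rewrite order_iso_321 !ltnS ji kj.
apply/(contains_pattern3P _ (erefl : size p321 = 3)) => -[i [j [k [ij jk]]]].
rewrite order_iso_321 !ltnS => /andP[kj ji].
by have := h _ _ _ ij jk ji; rewrite ltnNge (ltnW kj).
Qed.

Lemma avoiders213P s : reflect (avoids_213 s) (s \in avoiders n p213).
Proof.
rewrite inE; apply: (iffP idP) => [/(contains_pattern3P _ (erefl : size p213 = 3)) h|h].
  move=> i j k ij jk ji.
  rewrite ltn_neqAle eq_sym perm_neq_lt ?(ltn_trans ij) // leqNgt; apply/negP => ik.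
  by apply: h; exists i, j, k; rewrite order_iso_213 !ltnS ji ik.
apply/(contains_pattern3P _ (erefl : size p213 = 3)) => -[i [j [k [ij jk]]]].
rewrite order_iso_213 !ltnS => /andP[ji ik].
by have := h _ _ _ ij jk ji; rewrite ltnNge (ltnW ik).
Qed.

Lemma has3241_oneline s : has3241 (oneline s) ->
  exists i j k l : 'I_n, [/\ i < j, j < k, k < l & [/\ s l < s j, s j < s i & s i < s k]].
Proof.
case=> a [b [c [d [ab bc cd [db ba ac]]]]].
have [/onelineP[i ai] /onelineP[j bj]] := before_mem ab.
have [/onelineP[k ck] /onelineP[l dl]] := before_mem cd.
exists i, j, k, l; move: ab bc cd db ba ac; subst; rewrite !before_oneline.
by rewrite !ltnS.
Qed.

(** The letters 3, 2, 1 of a 3241 form a 321. *)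
Lemma avoids_321_no3241 s : avoids_321 s -> ~ has3241 (oneline s).
Proof.
move=> av /has3241_oneline[i [j [k [l [ij jk kl [lj ji _]]]]]].
by have := av _ _ _ ij (ltn_trans jk kl) ji; rewrite ltnNge (ltnW lj).
Qed.

(** The letters 3, 2, 4 of a 3241 form a 213. *)
Lemma avoids_213_no3241 s : avoids_213 s -> ~ has3241 (oneline s).
Proof.
move=> av /has3241_oneline[i [j [k [l [ij jk kl [_ ji ik]]]]]].
by have := av _ _ _ ij jk ji; rewrite ltnNge (ltnW ik).
Qed.

End Oneline.

(** * Lehmer codes *)

Lemma card_ord_lt n m : m <= n -> #|[set i : 'I_n | i < m]| = m.
Proof.
move=> mn; have -> : [set i : 'I_n | i < m] = widen_ord mn @: [set: 'I_m].
  apply/setP => i; rewrite inE; apply/idP/imsetP => [im|[j _ ->]] //=.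
  by exists (Ordinal im); rewrite ?inE //; apply/val_inj.
rewrite card_imset ?cardsT ?card_ord //.
by move=> i j /(congr1 val) ij; apply: val_inj.
Qed.

Section Lehmer.

Variable n : nat.
Implicit Type s : 'S_n.

Definition lcode s (i : 'I_n) := #|[set j : 'I_n | (j < i) && (s j < s i)]|.

Definition icode s (i : 'I_n) := #|[set j : 'I_n | (j < i) && (s i < s j)]|.

Lemma lcodeD s i : lcode s i + icode s i = i.
Proof.
rewrite -[RHS](card_ord_lt (ltnW (ltn_ord i))).
rewrite -[RHS](cardsID [set j | s j < s i]); congr (_ + _); apply: eq_card => j;
  rewrite !inE ?[_ && (j < i)]andbC //.
case: (ltnP j i) => //= ji.
by rewrite -leqNgt ltn_neqAle eq_sym perm_neq_lt.
Qed.

Lemma lcodeE s i : lcode s i = i - icode s i.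
Proof. by rewrite -{1}(lcodeD s i) addnK. Qed.

Lemma card_perm_lt s (m : nat) : m <= n -> #|[set j | s j < m]| = m.
Proof.
move=> mn; rewrite -[RHS](card_ord_lt mn) -[LHS](card_imset _ (@perm_inj _ s)).
apply: eq_card => i; rewrite inE; apply/imsetP/idP => [[j + ->]|im].
  by rewrite inE.
by exists (s^-1 i)%g; rewrite ?inE permKV.
Qed.

Lemma lt_iso_perm s (u : 'S_n) : (forall i j, (s i < s j) = (u i < u j)) -> s = u.
Proof.
move=> iso; apply/permP => i; apply: val_inj => /=.
rewrite -(card_perm_lt s (ltnW (ltn_ord (s i)))).
rewrite -[RHS](card_perm_lt u (ltnW (ltn_ord (u i)))).
by apply: eq_card => j; rewrite !inE iso.
Qed.

(* The positions before [i] with smaller letters form an initial segment of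
   the positions before [i], ordered by letter; so its size determines it. *)
Lemma lcode_inj s (u : 'S_n) : lcode s =1 lcode u -> s = u.
Proof.
move=> eq_code; apply: lt_iso_perm.
have neq (v : 'S_n) (i j : 'I_n) : j < i -> (v i < v j) = ~~ (v j < v i).
  by move=> ji; rewrite -leqNgt ltn_neqAle eq_sym perm_neq_lt.
suff iso m (i j : 'I_n) : i < m -> j < i -> (s j < s i) = (u j < u i).
  move=> i j; have [ij|ji|/val_inj->] := ltngtP i j; last by rewrite !ltnn.
  - exact: iso (ltnSn j) ij.
  - by rewrite (neq s _ _ ji) (neq u _ _ ji) (iso _ _ _ (ltnSn i) ji).
elim: m i j => // m IHm i j; rewrite ltnS leq_eqVlt => /predU1P[im|]; last exact: IHm.
have isom (a b : 'I_n) : a < i -> b < i -> (s a < s b) = (u a < u b).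
  rewrite im => am bm.
  have [ab|ba|/val_inj->] := ltngtP a b; last by rewrite !ltnn.
  - exact: IHm bm ab.
  - by rewrite (neq s _ _ ba) (neq u _ _ ba) (IHm _ _ am ba).
have low (v w : 'S_n) :
    (forall a b : 'I_n, a < i -> b < i -> (v a < v b) = (w a < w b)) ->
    lcode v i = lcode w i -> forall a : 'I_n, a < i -> v a < v i -> w a < w i.
  move=> vw eq_vw a ai av; rewrite ltnNge; apply/negP => aw.
  suff : lcode w i < lcode v i by rewrite eq_vw ltnn.
  apply/proper_card/properP; split.
    apply/subsetP => b; rewrite !inE => /andP[bi bw]; rewrite bi /=.
    by apply: ltn_trans av; rewrite vw // (leq_trans bw).
  by exists a; rewrite !inE ai //= ltnNge aw.
move=> ji; apply/idP/idP; first exact: low isom (eq_code i) _ ji.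
exact: low (fun a b ai bi => esym (isom a b ai bi)) (esym (eq_code i)) _ ji.
Qed.

End Lehmer.

Lemma lcode_surj n (f : nat -> nat) : (forall i, i < n -> f i <= i) ->
  exists s : 'S_n, forall i, lcode s i = f i.
Proof.
elim: n => [|n IHn] fle; first by exists 1%g => -[].
have [s sf] := IHn (fun i ni => fle i (ltnW ni)).
(* The new last letter is [f n]; the letters of [s] from [f n] on are raised by one, which keeps
   their relative order and hence their codes. *)
exists (lift_perm ord_max (inord (f n)) s) => i.
have fn : f n < n.+1 by rewrite ltnS fle.
have liftE (j : 'I_n) : lift ord_max j = j :> nat by rewrite /= /bump leqNgt ltn_ord.
case: (unliftP ord_max i) => [j|] ->.
  rewrite liftE -sf /lcode -[RHS](card_imset _ (@lift_inj _ ord_max)).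
  apply: eq_card => k; rewrite inE.
  case: (unliftP ord_max k) => [l|] ->.
    rewrite !liftE !lift_perm_lift mem_imset ?inE; last exact: lift_inj.
    by rewrite /= /bump; case: (ltnP l j) => //= _; lia.
  rewrite lift_perm_id liftE ltnNge (ltnW (ltn_ord j)) /=; symmetry; apply/negP.
  by case/imsetP => l _ /(congr1 val) /=; rewrite /bump; have := ltn_ord l; lia.
rewrite /lcode lift_perm_id /= inordK //.
rewrite -[RHS](card_perm_lt (lift_perm ord_max (inord (f n)) s) (ltnW fn)).
apply: eq_card => k; rewrite !inE.
case: (unliftP ord_max k) => [l|] ->; first by rewrite liftE ltn_ord.
by rewrite lift_perm_id inordK // !ltnn.
Qed.

(** * The code of a 321-avoiding permutation *)

Section Code321.

Variable n : nat.
Implicit Type s : 'S_n.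

Definition rcode s (i : 'I_n) := #|[set j : 'I_n | (i < j) && (s j < s i)]|.

Lemma perm_lcode_rcode s i : s i = lcode s i + rcode s i :> nat.
Proof.
rewrite -[LHS](card_perm_lt s (ltnW (ltn_ord (s i)))).
rewrite -(cardsID [set j : 'I_n | j < i]); congr (_ + _); apply: eq_card => j;
  rewrite !inE 1?andbC //.
by case: (ltngtP i j) => /= [_|_|/val_inj ->]; rewrite ?ltnn ?andbT ?andbF.
Qed.

(** If [m] is the least letter at positions from [j] on, the [m] smaller letters all lie before [j],
    so this set has [j - m] elements. Counting it directly gives 0 at [j = n] without a convention
    for an empty minimum. *)
Definition xset s (j : nat) :=
  [set i : 'I_n | (i < j) && [exists k : 'I_n, (j <= k) && (s k < s i)]].

Definition xcode s j := #|xset s j|.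

Lemma xsetP s j (i : 'I_n) :
  reflect (i < j /\ exists2 k : 'I_n, j <= k & s k < s i) (i \in xset s j).
Proof.
rewrite inE; apply: (iffP andP) => [[ij /existsP[k /andP[]]]|[ij [k jk ki]]].
  by split => //; exists k.
by split => //; apply/existsP; exists k; rewrite jk.
Qed.

Lemma xcode0 s : xcode s 0 = 0.
Proof. by apply: eq_card0 => i; rewrite inE. Qed.

Lemma xcode_ge s j : n <= j -> xcode s j = 0.
Proof.
move=> nj; apply: eq_card0 => i; apply/negP => /xsetP[_ [k jk _]].
by have := ltn_ord k; rewrite ltnNge (leq_trans nj).
Qed.

Lemma xcodeS_le s j : xcode s j.+1 <= (xcode s j).+1.
Proof.
have [jn|nj] := ltnP j n; last by rewrite xcode_ge // leqW.
have -> : (xcode s j).+1 = 1 + xcode s j by [].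
rewrite -(cards1 (Ordinal jn)); apply: leq_trans (leq_card_setU _ _).
apply/subset_leq_card/subsetP => i /xsetP[ij [k jk ki]]; rewrite in_setU1.
case: eqVneq => //= ne; apply/xsetP; split; last by exists k => //; apply: ltnW.
by rewrite ltn_neqAle -ltnS ij andbT.
Qed.

Variant xcode_spec s (i : 'I_n) : Prop :=
  | XcodeDrop of s i < i & 0 < icode s i & xcode s i = icode s i
      & xcode s i.+1 <= xcode s i
  | XcodeFix of s i = i :> nat & icode s i = 0 & xcode s i = 0 & xcode s i.+1 = 0
  | XcodeExc of i < s i & icode s i = 0 & xcode s i.+1 = (xcode s i).+1.

(** If a larger letter precedes [i], avoidance of 321 makes [s i] the least letter from [i] on: a
    drop, with [xset s i] the set of larger earlier letters. Otherwise [s i] exceeds all earlier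
    letters. It is then fixed if no smaller letter follows; if one does, it is an excedance and
    [xset] gains exactly [i]. *)
Lemma xcodeP s i : avoids_321 s -> xcode_spec s i.
Proof.
move=> av; have eq_s := perm_lcode_rcode s i; have eq_i := lcodeD s i.
have [i0|i_gt0] := posnP (icode s i).
  have below (j : 'I_n) : j < i -> s j < s i.
    move=> ji; have := card0_eq i0 j; rewrite !inE ji /= ltnNge => /negbFE.
    by rewrite leq_eqVlt (negPf (perm_neq_lt s ji)).
  have [r0|r_gt0] := posnP (rcode s i).
    have above (k : 'I_n) : i < k -> s i < s k.
      move=> ik; have := card0_eq r0 k; rewrite !inE ik /= ltnNge => /negbFE.
      by rewrite leq_eqVlt (negPf (perm_neq_lt s ik)).
    have le_above (k : 'I_n) : i <= k -> s i <= s k.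
      by rewrite leq_eqVlt => /predU1P[/val_inj -> //|/above/ltnW].
    apply: XcodeFix; rewrite ?eq_s //; try lia.
      apply: eq_card0 => j; apply/negP => /xsetP[ji [k ik kj]].
      by have := leq_trans (below _ ji) (le_above _ ik); rewrite ltnNge (ltnW kj).
    apply: eq_card0 => j; apply/negP => /xsetP[ji [k ik kj]].
    have : s j <= s i.
      move: ji; rewrite ltnS leq_eqVlt => /predU1P[/val_inj -> //|/below/ltnW //].
    by move/leq_ltn_trans/(_ (above _ ik)); rewrite ltnNge (ltnW kj).
  apply: XcodeExc => //; first lia.
  have /card_gt0P[k] := r_gt0; rewrite inE => /andP[ik ki].
  have -> : (xcode s i).+1 = (i \notin xset s i) + xcode s i.
    by rewrite inE ltnn.
  rewrite -cardsU1; apply: eq_card => j; rewrite in_setU1.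
  apply/xsetP/predU1P => [[ji [l il lj]]|[->|/xsetP[ji [l il lj]]]].
  - move: ji; rewrite ltnS leq_eqVlt => /predU1P[/val_inj -> |ji]; first by left.
    by right; apply/xsetP; split => //; exists l => //; apply: ltnW.
  - by split => //; exists k.
  - split; first exact: ltnW.
    have [/val_inj eq_il|ne] := eqVneq (i : nat) l; last first.
      by exists l => //; rewrite ltn_neqAle ne.
    by move: lj; rewrite -eq_il ltnNge ltnW // below.
have /card_gt0P[h] := i_gt0; rewrite inE => /andP[hi ih].
have above (k : 'I_n) : i < k -> s i < s k by move=> ik; apply: av ik ih.
have r0 : rcode s i = 0.
  apply: eq_card0 => k; rewrite inE; apply/negP => /andP[/above].
  by rewrite ltnNge => /negP ki /ltnW.
apply: XcodeDrop => //; first lia.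
  apply: eq_card => j; rewrite [RHS]inE.
  apply/xsetP/andP => [[ji [k ik kj]]|[ji ij]]; split => //; last by exists i.
  move: ik; rewrite leq_eqVlt => /predU1P[/val_inj -> //|/above ik].
  exact: ltn_trans kj.
apply/subset_leq_card/subsetP => j /xsetP[ji [k ik kj]].
move: ji; rewrite ltnS leq_eqVlt => /predU1P[/val_inj ji|ji].
  by have := above _ ik; rewrite -ji ltnNge (ltnW kj).
by apply/xsetP; split => //; exists k => //; apply: ltnW.
Qed.

(** This recovers the path from right to left. The predecessor undoes the up step of an excedance,
    and its truncation at 0 covers the fixed points. *)
Lemma xcode_icode s (i : 'I_n) : avoids_321 s ->
  xcode s i = if 0 < icode s i then icode s i else (xcode s i.+1).-1.
Proof. by case/(xcodeP i) => [_ -> ->|_ -> -> ->|_ -> ->]. Qed.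

Lemma icode_xcode s i : avoids_321 s ->
  icode s i = if xcode s i.+1 <= xcode s i then xcode s i else 0.
Proof. by case/(xcodeP i) => [_ _ -> ->|_ -> -> ->|_ -> ->] //; rewrite ltnn. Qed.

Lemma xcode_inj s (u : 'S_n) : avoids_321 s -> avoids_321 u ->
  (forall i : 'I_n, xcode s i.+1 = xcode u i.+1) -> s = u.
Proof.
move=> avs avu eq_x; apply: lcode_inj => i; rewrite !lcodeE !icode_xcode // eq_x.
suff -> : xcode s i = xcode u i by [].
case: i => -[|i] ilt /=; first by rewrite !xcode0.
exact: (eq_x (Ordinal (ltnW ilt))).
Qed.

Lemma fix_xcode s (i : 'I_n) : avoids_321 s ->
  (s i == i) = (xcode s i == 0) && (xcode s i.+1 == 0).
Proof.
rewrite -val_eqE /=.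
by case/(xcodeP i) => [h1 h2 h3 h4|h1 h2 h3 h4|h1 h2 h3]; lia.
Qed.

Lemma drop_xcode s (i : 'I_n) : avoids_321 s ->
  (s i < i) = (0 < xcode s i) && (xcode s i.+1 <= xcode s i).
Proof. by case/(xcodeP i) => [h1 h2 h3 h4|h1 h2 h3 h4|h1 h2 h3]; lia. Qed.

(** Let [k] hold the least letter after [i]. It lies below all letters of [xset s i.+1], and these
    increase, since a descending pair followed by [s k] would be a 321. Conversely, a sequence
    rising over [k] lies in [xset s k]. *)
Lemma sortable_xcode t s : avoids_321 s ->
  stack_sortable t s <-> forall i : 'I_n, xcode s i.+1 <= t.
Proof.
move=> av; rewrite stack_sortableE sorted_iter_stack_sort ?oneline_uniq //;
  last exact: avoids_321_no3241.
rewrite rises_over_oneline; split=> [nr i|xt [k [A [tA Ak _]]]].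
  rewrite leqNgt; apply/negP => tx; apply: nr.
  have /card_gt0P[j0 /xsetP[_ [k0 ik0 _]]] := leq_ltn_trans (leq0n t) tx.
  case: (arg_minnP (P := fun k : 'I_n => i < k) (fun k => val (s k)) ik0) => k ik kmin.
  have below (j : 'I_n) : j \in xset s i.+1 -> s k < s j.
    by case/xsetP => _ [l il lj]; apply: leq_ltn_trans lj; apply: kmin.
  exists k, (xset s i.+1); split => // [j js|j l js ls jl].
    by split; [case/xsetP: js => ji _; apply: leq_trans ik | apply: below].
  rewrite ltn_neqAle perm_neq_lt // leqNgt; apply/negP => lj.
  have lk : l < k by case/xsetP: ls => li _; apply: leq_trans ik.
  by have := av _ _ _ jl lk lj; rewrite ltnNge (ltnW (below _ ls)).
have /card_gt0P[i0 /Ak[i0k _]] := leq_ltn_trans (leq0n t) tA.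
(* A member of [A] lies before [k], so [k] is positive and the bound at [k.-1] is one on
   [xcode s k]. *)
have k1 : k.-1 < n by rewrite (leq_ltn_trans (leq_pred k)).
have := xt (Ordinal k1); rewrite /= (ltn_predK i0k) leqNgt => /negP; apply.
apply: leq_trans tA _; apply/subset_leq_card/subsetP => i /Ak[ik ki].
by apply/xsetP; split => //; exists k.
Qed.

(** In a 321 the middle position [j] has [icode s j > 0], hence [icode s j = x j] and
    [x j.+1 <= x j]. For the nearest later [k] with a smaller letter, [icode s k] is at least
    [x j + (k - j)], while unit growth from [j.+1] only allows [x k <= x j + (k - j) - 1]. *)
Lemma avoids_321_code s (x : nat -> nat) :
  (forall j, j < n -> x j.+1 <= (x j).+1) ->
  (forall i : 'I_n, icode s i = if x i.+1 <= x i then x i else 0) ->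
  avoids_321 s.
Proof.
move=> xS sx.
have grow (m : nat) j : j + m <= n -> x (j + m) <= x j + m.
  elim: m => [|m IHm]; rewrite ?addn0 // !addnS => jm.
  by apply: leq_trans (xS _ jm) _; rewrite ltnS IHm // ltnW.
suff no_inv m (j k : 'I_n) : k - j < m -> j < k -> 0 < icode s j -> s j < s k.
  move=> i j k ij jk ji; apply: no_inv jk _ => //.
  by apply/card_gt0P; exists i; rewrite inE ij.
elim: m j k => // m IHm j k kjm jk j_gt0.
rewrite ltn_neqAle perm_neq_lt // leqNgt; apply/negP => kj.
(* By minimality of [k - j], no letter between positions [j] and [k] is
   smaller than [s k], so all of them count in [icode s k]. *)
have btw (l : 'I_n) : j <= l -> l < k -> s k < s l.
  rewrite leq_eqVlt => /predU1P[/val_inj <- //|jl lk].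
  rewrite ltnNge; apply/negP => le_lk.
  have : s j < s l by apply: IHm; rewrite //; lia.
  by rewrite ltnNge (leq_trans le_lk) // ltnW.
have ik : icode s j + (k - j) <= icode s k.
  rewrite /icode -(cardsID [set i : 'I_n | i < j] [set _ | _ & s k < _]).
  apply: leq_add.
    apply/subset_leq_card/subsetP => i; rewrite !inE => /andP[ij ji].
    by rewrite ij (ltn_trans ij jk) (ltn_trans kj ji).
  have -> : k - j = #|[set i : 'I_n | j <= i < k]|.
    have := cardsID [set i : 'I_n | i < j] [set i : 'I_n | i < k].
    have -> : [set i : 'I_n | i < k] :&: [set i : 'I_n | i < j]
              = [set i : 'I_n | i < j].
      by apply/setP => i; rewrite !inE andb_idl // => /ltn_trans; apply.
    have -> : [set i : 'I_n | i < k] :\: [set i : 'I_n | i < j]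
              = [set i : 'I_n | j <= i < k].
      by apply/setP => i; rewrite !inE -leqNgt.
    by rewrite !card_ord_lt ?(ltnW (ltn_ord _)) // => /(canRL (addKn _)).
  apply/subset_leq_card/subsetP => i; rewrite !inE -leqNgt => /andP[ji ik].
  by rewrite ji ik btw.
have := grow (k - j.+1) j.+1; rewrite subnKC // => /(_ (ltnW (ltn_ord k))).
move: ik j_gt0; rewrite !sx; do 2 case: ifP => //; lia.
Qed.

Lemma xcode_surj (x : nat -> nat) : x 0 = 0 -> x n = 0 ->
  (forall j, j < n -> x j.+1 <= (x j).+1) ->
  exists2 s, avoids_321 s & forall j, j <= n -> xcode s j = x j.
Proof.
move=> x0 xn xS.
have xle j : j <= n -> x j <= j.
  by elim: j => [|j IHj] jn; rewrite ?x0 // (leq_trans (xS _ jn)) // ltnS IHj // ltnW.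
(* The value that [icode_xcode] forces on [icode]; its complement to [j] is the Lehmer code to
   realise. *)
pose d j := if x j.+1 <= x j then x j else 0.
have dle j : j < n -> d j <= j.
  by move=> jn; rewrite /d; case: ifP => // _; rewrite xle // ltnW.
have [s sd] := @lcode_surj n (fun j => j - d j) (fun j _ => leq_subr _ _).
have icd (i : 'I_n) : icode s i = d i.
  by have := lcodeD s i; rewrite sd; have := dle i (ltn_ord i); lia.
have av : avoids_321 s := avoids_321_code xS icd.
(* Downward induction from position [n], where both paths are 0, by means of [xcode_icode]. *)
exists s => // j jn; rewrite -(subKn jn).
elim: (n - j) (leq_subr j n) => [|m IHm] mn; first by rewrite subn0 xn xcode_ge.
have {}IHm := IHm (ltnW mn).
have lt : n - m.+1 < n by lia.
have eS : (n - m.+1).+1 = n - m by lia.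
have := @xcode_icode s (Ordinal lt) av; rewrite icd /= eS IHm => ->.
rewrite /d eS; have := xS _ lt; rewrite eS.
case: (leqP (x (n - m)) (x (n - m.+1))) => /=; last by case: (x (n - m)) => /=; lia.
by case: (x (n - m.+1)) => /=; lia.
Qed.

End Code321.

(** * The code of a 213-avoiding permutation *)

Section Code213.

Variable n : nat.
Implicit Type s : 'S_n.

Definition wset s (i : 'I_n) :=
  [set j : 'I_n | [&& j <= i, s j <= s i & ~~ rl_min s j]].

Definition wcode s (i : 'I_n) := #|wset s i|.

Lemma rl_minP s (i : 'I_n) :
  reflect (forall j : 'I_n, i < j -> s i < s j) (rl_min s i).
Proof. exact: 'forall_implyP. Qed.

Lemma rl_minPn s (i : 'I_n) :
  reflect (exists2 j : 'I_n, i < j & s j < s i) (~~ rl_min s i).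
Proof.
rewrite negb_forall; apply: (iffP existsP) => [[j]|[j ij ji]].
  rewrite negb_imply -leqNgt => /andP[ij ji]; exists j => //.
  by rewrite ltn_neqAle ji eq_sym perm_neq_lt.
by exists j; rewrite ij /= -leqNgt ltnW.
Qed.

Lemma wsetP s (i j : 'I_n) :
  reflect [/\ j <= i, s j <= s i & exists2 k : 'I_n, j < k & s k < s j] (j \in wset s i).
Proof.
by rewrite inE; apply: (iffP and3P) => [] [ji sji /rl_minPn nm].
Qed.

Lemma mem_wset s (i : 'I_n) : (i \in wset s i) = ~~ rl_min s i.
Proof. by rewrite inE !leqnn. Qed.

(** Let [i] be a right-to-left minimum with [j] in [wset s i], and let [k] after [j] hold a letter
    below [s j]. Then [k < i] gives the 213 [j k i], and [k >= i] contradicts the minimality of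
    [s i] or [s j <= s i]. *)
Lemma rl_min_wcode s (i : 'I_n) : avoids_213 s -> rl_min s i = (wcode s i == 0).
Proof.
move=> av; apply/idP/idP => [im|]; last first.
  by apply: contraTT; rewrite -mem_wset => iw; rewrite -lt0n; apply/card_gt0P; exists i.
rewrite cards_eq0; apply/eqP/setP => j; rewrite in_set0; apply/wsetP => -[ji sji].
move: ji; rewrite leq_eqVlt => /predU1P[/val_inj eq_ji|ji] [k jk kj].
  by have := rl_minP _ _ im k; rewrite -eq_ji => /(_ jk); rewrite ltnNge (ltnW kj).
have [ki|ik|/val_inj eq_ki] := ltngtP k i.
- by have := av _ _ _ jk ki kj; rewrite ltnNge sji.
- by have := rl_minP _ _ im k ik; rewrite ltnNge (leq_trans (ltnW kj)).
- by move: kj; rewrite eq_ki ltnNge sji.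
Qed.

Lemma wcode_last s (i : 'I_n) : avoids_213 s -> i.+1 = n -> wcode s i = 0.
Proof.
move=> av i_n; apply/eqP; rewrite -rl_min_wcode //; apply/rl_minP => j ij.
have : j < i.+1 by rewrite i_n.
by rewrite ltnS leqNgt ij.
Qed.

Lemma wcode_first s (i : 'I_n) : i = 0 :> nat -> wcode s i <= 1.
Proof.
move=> i0; rewrite -(cards1 i); apply/subset_leq_card/subsetP => j /wsetP[].
by rewrite i0 leqn0 inE -val_eqE /= i0.
Qed.

(** At an ascent [k] is a child of [i] in the forest, so only [k] can be new. If a smaller letter
    follows [i], it also follows [k] and is below [s k], so [k] does count. *)
Lemma wcode_ascent s (i k : 'I_n) : avoids_213 s -> k = i.+1 :> nat -> s i < s k ->
  wcode s k <= (wcode s i).+1 /\ (~~ rl_min s i -> wcode s k = (wcode s i).+1).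
Proof.
move=> av ki ik.
have ltik : i < k by rewrite ki.
have sub (j : 'I_n) : j != k -> (j \in wset s k) = (j \in wset s i).
  move=> jk; apply/wsetP/wsetP => -[h1 h2 h3]; split => //.
  - by move: h1; rewrite leq_eqVlt val_eqE (negPf jk) ki.
  - move: h1; rewrite leq_eqVlt val_eqE (negPf jk) ki ltnS leq_eqVlt /=.
    case/predU1P => [/val_inj -> //|ji]; rewrite leqNgt; apply/negP => ij.
    by have := av _ _ _ ji ltik ij; rewrite ltnNge h2.
  - by rewrite ltnW // ki ltnS.
  - by rewrite (leq_trans h2) // ltnW.
have kNi : k \notin wset s i by apply/wsetP => -[]; rewrite ki ltnn.
have -> : (wcode s i).+1 = #|k |: wset s i| by rewrite cardsU1 kNi.
have eq_w (ks : k \in wset s k) : wset s k = k |: wset s i.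
  by apply/setP => j; rewrite in_setU1; case: (eqVneq j k) => [->|/sub].
split=> [|/rl_minPn[b ib bi]].
  apply/subset_leq_card/subsetP => j; rewrite in_setU1.
  by case: (eqVneq j k) => //= /sub ->.
apply/eq_card; rewrite eq_w //; apply/wsetP; split => //; exists b.
  rewrite ltn_neqAle ki ib andbT; apply: contraTneq bi => ib'.
  by have -> : b = k; [apply: val_inj; rewrite /= -ib' | rewrite -leqNgt ltnW].
exact: ltn_trans ik.
Qed.

Lemma wcode_descent s (i k : 'I_n) : k = i.+1 :> nat -> s k < s i ->
  0 < wcode s i /\ wcode s k <= wcode s i.
Proof.
move=> ki lt_ki.
have ltik : i < k by rewrite ki.
have iw : i \in wset s i by apply/wsetP; split => //; exists k.
split; first by apply/card_gt0P; exists i.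
(* [k] takes the place of [i]. Inserting [k] explicitly covers both the case where it belongs to
   [wset s k] and the case where it does not. *)
rewrite /wcode (cardsD1 i (wset s i)) iw /=; apply: leq_trans (_ : #|k |: (wset s k :\ k)| <= _).
  by apply/subset_leq_card/subsetP => j; rewrite !inE; case: (j == k).
apply: leq_trans (leq_card_setU _ _) _; rewrite cards1 leq_add2l.
apply/subset_leq_card/subsetP => j /setD1P[jk /wsetP[h1 h2 h3]].
have ji : j <= i by move: h1; rewrite leq_eqVlt val_eqE (negPf jk) ki.
apply/setD1P; split; last by apply/wsetP; split; rewrite // (leq_trans h2) // ltnW.
by apply: contraTneq h2 => ->; rewrite -ltnNge.
Qed.

Lemma wcodeS_le s (i k : 'I_n) : avoids_213 s -> k = i.+1 :> nat ->
  wcode s k <= (wcode s i).+1.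
Proof.
move=> av ki; have ik : i < k by rewrite ki.
have [/(wcode_ascent av ki)[]//|/(wcode_descent ki)[_ /leqW]//|e] := ltngtP (s i) (s k).
by have := perm_neq_lt s ik; rewrite e eqxx.
Qed.

Lemma descent_wcode s (i k : 'I_n) : avoids_213 s -> k = i.+1 :> nat ->
  (s k < s i) = (0 < wcode s i) && (wcode s k <= wcode s i).
Proof.
move=> av ki; have ik : i < k by rewrite ki.
have [/(wcode_descent ki)[-> ->]//|lt_ik|e] := ltngtP (s k) (s i); last first.
  by have := perm_neq_lt s ik; rewrite e eqxx.
rewrite lt0n -rl_min_wcode //; case: (boolP (rl_min s i)) => //= nm.
by have [_ ->] := wcode_ascent av ki lt_ik; rewrite ?ltnn.
Qed.

(** This turns the ascent condition in the definition of a bad point into a condition on [wcode] at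
    the previous position. *)
Lemma rl_min_ascent s (i k : 'I_n) : k = i.+1 :> nat -> rl_min s k ->
  (s i < s k) = rl_min s i.
Proof.
move=> ki km; apply/idP/rl_minP => [lt_ik j|->//]; last by rewrite ki.
rewrite leq_eqVlt -ki => /predU1P[/val_inj <- //|kj].
exact: ltn_trans lt_ik (rl_minP _ _ km _ kj).
Qed.

(* In the forest whose preorder word is [s], the ancestors of [i] are the
   right-to-left minima before [i] together with the other ancestors, which
   [wcode] counts. *)
Lemma lcode_wcode s (i : 'I_n) : avoids_213 s ->
  lcode s i = (wcode s i).-1 + #|[set j : 'I_n | (j < i) && (wcode s j == 0)]|.
Proof.
move=> av; rewrite /lcode -(cardsID [set j | rl_min s j]) addnC; congr (_ + _).
  (* The predecessor discounts [i] itself; when [i] is a right-to-left minimum both sides are 0. *)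
  have -> : (wcode s i).-1 = #|wset s i :\ i|.
    have := cardsD1 i (wset s i); rewrite /wcode; case: (boolP (i \in _)) => [_ -> //|iN].
    rewrite mem_wset negbK rl_min_wcode // in iN.
    by rewrite add0n => <-; rewrite [#|_|](eqP iN).
  apply: eq_card => j; rewrite !inE -val_eqE /=.
  have [ji|ij|/val_inj ->] := ltngtP j i; rewrite ?andbF ?andbT //=.
  by rewrite andbC ltn_neqAle perm_neq_lt.
apply: eq_card => j; rewrite !inE -rl_min_wcode //; case: (ltnP j i) => //= ji.
by rewrite andb_idl // => /rl_minP /(_ _ ji).
Qed.

Lemma wcode_inj s (u : 'S_n) : avoids_213 s -> avoids_213 u ->
  wcode s =1 wcode u -> s = u.
Proof.
move=> avs avu eq_w; apply: lcode_inj => i; rewrite !lcode_wcode // eq_w.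
by congr (_ + _); apply: eq_card => j; rewrite !inE eq_w.
Qed.

(** If [s i < s j < s k] with [j] before the adjacent positions [i], [k], then [lcode s k] counts
    [i], [j] and all that [lcode s i] counts, a rise of at least two. So once the word is below
    [s j] it stays below, one step at a time. *)
Lemma avoids_213_code s :
  (forall i k : 'I_n, k = i.+1 :> nat -> lcode s k <= (lcode s i).+1) -> avoids_213 s.
Proof.
move=> sl.
have adj (j i k : 'I_n) : j < i -> k = i.+1 :> nat -> s i < s j -> s k < s j.
  move=> ji ki ij; have ik : i < k by rewrite ki.
  rewrite ltn_neqAle eq_sym perm_neq_lt ?(ltn_trans ji) // leqNgt; apply/negP => jk.
  have := sl i k ki; rewrite leqNgt => /negP; apply; rewrite /lcode.
  have sub : j |: (i |: [set a : 'I_n | (a < i) && (s a < s i)])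
             \subset [set a : 'I_n | (a < k) && (s a < s k)].
    apply/subsetP => a; rewrite !inE => /or3P[/eqP->|/eqP->|/andP[ai si]].
    - by rewrite (ltn_trans ji).
    - by rewrite ik (ltn_trans ij).
    - by rewrite (ltn_trans ai) // (ltn_trans si) // (ltn_trans ij).
  apply: leq_trans (subset_leq_card sub).
  have ji' : (s j < s i) = false by rewrite ltnNge (ltnW ij).
  by rewrite !cardsU1 !inE ltnn -val_eqE /= ltn_eqF // ji ji'.
move=> j i k ji.
elim: {k}(k : nat) {-2}k (erefl (k : nat)) => [|m IHm] k km ik ij; first by rewrite km in ik.
have mn : m < n by rewrite -ltnS -km ltnW // ltnS.
pose k' := Ordinal mn.
have [ik'|k'i] := ltnP i k'; last first.
  by apply: adj ij => //; apply/eqP; rewrite eqn_leq ik km ltnS k'i.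
by apply: (adj _ k'); rewrite ?(ltn_trans ji) // IHm.
Qed.

(** Let [a] hold the least letter of [wset s i] and [b] a smaller letter after it. No member of
    [wset s i] comes after [b], and its letters increase, since otherwise a 213 or a letter above
    [s i] appears. Conversely, a set [A] rising over [k] lies in [wset s l] for its last position
    [l]. *)
Lemma sortable_wcode t s : avoids_213 s ->
  stack_sortable t s <-> forall i : 'I_n, wcode s i <= t.
Proof.
move=> av; rewrite stack_sortableE sorted_iter_stack_sort ?oneline_uniq //;
  last exact: avoids_213_no3241.
rewrite rises_over_oneline; split=> [nr i|wt [k [A [tA Ak AA]]]].
  rewrite leqNgt; apply/negP => tw; apply: nr.
  have /card_gt0P[j0 j0w] := leq_ltn_trans (leq0n t) tw.
  case: (arg_minnP (fun j : 'I_n => val (s j)) j0w) => a aw amin.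
  have /wsetP[ai sai [b ab ba]] := aw.
  exists b, (wset s i); split => // [j jw|j l jw lw jl].
    have sj : s a <= s j by apply: amin.
    have bj : s b < s j := leq_trans ba sj.
    split=> //; have [//|lt_bj|/val_inj e] := ltngtP j b; last by rewrite e ltnn in bj.
    by have := av _ _ _ ab lt_bj ba; rewrite ltnNge sj.
  have /wsetP[li sli _] := lw; have /wsetP[ji sji _] := jw.
  rewrite ltn_neqAle perm_neq_lt // leqNgt; apply/negP => lj.
  move: li; rewrite leq_eqVlt => /predU1P[/val_inj e|li].
    by move: sji; rewrite -e leqNgt lj.
  by have := av _ _ _ jl li lj; rewrite ltnNge sji.
have /card_gt0P[i0 i0A] := leq_ltn_trans (leq0n t) tA.
case: (arg_maxnP (fun j : 'I_n => val j) i0A) => l lA lmax.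
have := wt l; rewrite leqNgt => /negP; apply.
apply: leq_trans tA _; apply/subset_leq_card/subsetP => j jA.
have [jk kj] := Ak _ jA; have jl : j <= l by apply: lmax.
apply/wsetP; split => //; last by exists k.
move: jl; rewrite leq_eqVlt => /predU1P[/val_inj -> //|jl].
by rewrite ltnW // AA.
Qed.

End Code213.

(** * The bijection *)

Section Linked.

Variable n : nat.
Implicit Types s u : 'S_n.

(** The shift by one aligns the ends: [xcode s n] and the last value of [wcode u] are both 0, and
    [xcode s 0] is always 0. *)
Definition linked s u := forall i : 'I_n, xcode s i.+1 = wcode u i.

Lemma linked_sortable s u t : avoids_321 s -> avoids_213 u -> linked s u ->
  stack_sortable t s <-> stack_sortable t u.
Proof.
move=> avs avu su; rewrite sortable_xcode // sortable_wcode //.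
by split=> h i; have := h i; rewrite su.
Qed.

(** Zeros of the path at [i] and [i.+1] say that positions [i - 1] and [i] of [u] are right-to-left
    minima, which by [rl_min_ascent] makes [i] a bad point. *)
Lemma linked_fixpts s u : avoids_321 s -> avoids_213 u -> linked s u ->
  fixpts s = bad u.
Proof.
move=> avs avu su; apply: eq_card => i; rewrite !inE fix_xcode // andbC su.
rewrite -rl_min_wcode //; case: (boolP (rl_min u i)) => //= im.
case: i im => -[|m] mn im /=; first by rewrite xcode0.
pose k := Ordinal (ltnW mn).
rewrite (su k) -rl_min_wcode // -(@rl_min_ascent _ _ k (Ordinal mn)) //.
apply/idP/existsP => [ki|[j /andP[/eqP[kj] ji]]]; first by exists k; rewrite eqxx.
by have -> : k = j by apply: val_inj.
Qed.

Lemma linked_drops s u : avoids_321 s -> avoids_213 u -> linked s u ->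
  drops s = des u.
Proof.
move=> avs avu su; rewrite /drops /des.
(* A descent of [u] at [i] matches a drop of [s] at [i.+1]. The cyclic successor [ordS] never wraps
   around here, as a descent is not at the last position. *)
set D := [set i | [exists j, _]]; rewrite -(card_imset D (@ordS_inj n)).
apply: eq_card => j; rewrite inE drop_xcode // su; apply/idP/imsetP => [|[i]].
  case: j => -[|m] mn /=; first by rewrite xcode0.
  pose i := Ordinal (ltnW mn); rewrite (su i) -descent_wcode // => ji.
  exists i; last by apply: val_inj; rewrite /= modn_small.
  by rewrite inE; apply/existsP; exists (Ordinal mn); rewrite eqxx.
rewrite inE => /existsP[k /andP[/eqP ki lt_ki]] ->.
have -> : ordS i = k by apply: val_inj; rewrite /= -ki modn_small.
by rewrite ki su -descent_wcode.
Qed.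

Lemma linked_exists u : avoids_213 u -> exists2 s, avoids_321 s & linked s u.
Proof.
(* The path starts at 0 and then lists [wcode u]; the default 0 is taken only beyond [n]. *)
move=> av; pose x j := if j is i.+1 then oapp (wcode u) 0 (insub i) else 0.
have xE (i : 'I_n) : x i.+1 = wcode u i by rewrite /= valK.
have xn : x n = 0.
  case: {2}n (erefl n) => [->//|m nm].
  have mn : m < n by rewrite nm.
  by rewrite nm (xE (Ordinal mn)) wcode_last.
have xS j : j < n -> x j.+1 <= (x j).+1.
  move=> jn; rewrite (xE (Ordinal jn)).
  case: j jn => [|j] jn; first exact: wcode_first.
  by rewrite (xE (Ordinal (ltnW jn))) wcodeS_le.
have [s avs sx] := xcode_surj (erefl : x 0 = 0) xn xS.
by exists s => // i; rewrite sx ?ltn_ord.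
Qed.

(** This [u] is in general not linked to [s]: the path serves directly as a Lehmer code, which is
    enough to compare cardinalities. *)
Lemma lcode_xcode_exists s : avoids_321 s ->
  exists2 u, avoids_213 u & forall i : 'I_n, lcode u i = xcode s i.
Proof.
move=> av.
have xle j : j < n -> xcode s j <= j.
  move=> _; elim: j => [|j IHj]; first by rewrite xcode0.
  by rewrite (leq_trans (xcodeS_le _ _)).
have [u ux] := lcode_surj xle.
exists u => //; apply: avoids_213_code => i k ki.
by rewrite !ux ki xcodeS_le.
Qed.

(** The partner map [h] from 213-avoiders to 321-avoiders is injective by [wcode_inj]. The map [g]
    injects the other way, so [h] is bijective by counting, and its inverse is [Upsilon]. *)
Lemma linked_bijection :
  exists Upsilon : {s : 'S_n | s \in avoiders n p321} ->
                   {s : 'S_n | s \in avoiders n p213},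
    bijective Upsilon /\
    forall s : {s : 'S_n | s \in avoiders n p321}, linked (sval s) (sval (Upsilon s)).
Proof.
pose A := {s : 'S_n | s \in avoiders n p321}.
pose B := {s : 'S_n | s \in avoiders n p213}.
have avA (a : A) : avoids_321 (sval a) by apply/avoiders321P/(valP a).
have avB (b : B) : avoids_213 (sval b) by apply/avoiders213P/(valP b).
have [h hP] : exists h : B -> A, forall b, linked (sval (h b)) (sval b).
  apply: (@fin_all_exists B (fun=> A) (fun b a => linked (sval a) (sval b))) => b.
  have [s /avoiders321P avs sb] := linked_exists (avB b).
  by exists (exist _ s avs).
have [g gP] : exists g : A -> B, forall a i, lcode (sval (g a)) i = xcode (sval a) i.
  apply: (@fin_all_exists A (fun=> B)
    (fun a b => forall i : 'I_n, lcode (sval b) i = xcode (sval a) i)) => a.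
  have [u /avoiders213P avu ua] := lcode_xcode_exists (avA a).
  by exists (exist _ u avu).
have g_inj : injective g.
  move=> a b eq_g; apply: val_inj; apply: xcode_inj (avA a) (avA b) _ => i.
  (* Lehmer codes only reach positions below [n]; at [n] both paths vanish. *)
  have [lt_in|] := ltnP i.+1 n; last by move=> h1; rewrite !xcode_ge.
  by rewrite -(gP a (Ordinal lt_in)) -(gP b (Ordinal lt_in)) eq_g.
have h_inj : injective h.
  move=> a b eq_h; apply: val_inj; apply: wcode_inj (avB a) (avB b) _ => i.
  by rewrite -!hP eq_h.
have [h' hK h'K] := inj_card_bij h_inj (leq_card g g_inj).
exists h'; split; first by exists h.
by move=> s; have := hP (h' s); rewrite h'K.
Qed.

End Linked.

Theorem theorem1p2 (n : nat) (hn : 1 <= n) :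
  (exists Upsilon : {s : 'S_n | s \in avoiders n p321} ->
                    {s : 'S_n | s \in avoiders n p213},
     bijective Upsilon /\
     forall s : {s : 'S_n | s \in avoiders n p321},
       (forall t : nat, 1 <= t ->
          (stack_sortable t (sval s) <-> stack_sortable t (sval (Upsilon s)))) /\
       fixpts (sval s) = bad (sval (Upsilon s)) /\
       drops (sval s) = des (sval (Upsilon s)))
  /\
  (forall t : nat, 1 <= t ->
   forall (R : comNzRingType) (r x : R),
     (\sum_(s in sortable_avoiders t n p321)
         r ^+ fixpts s * x ^+ drops s =
      \sum_(s in sortable_avoiders t n p213)
         r ^+ bad s * x ^+ des s)%R).
Proof.
have [f [bij_f fP]] := linked_bijection n.
have stats (s : {s : 'S_n | s \in avoiders n p321}) :
    (forall t, stack_sortable t (sval s) <-> stack_sortable t (sval (f s))) /\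
    fixpts (sval s) = bad (sval (f s)) /\ drops (sval s) = des (sval (f s)).
  have avs := avoiders321P _ (valP s); have avf := avoiders213P _ (valP (f s)).
  split; first by move=> t; apply: linked_sortable avs avf (fP s).
  by split; [apply: linked_fixpts | apply: linked_drops].
split.
  exists f; split => // s; have [st fd] := stats s; split => // t _; exact: st.
move=> t _ R r x.
(* Sums are moved to the subtype of avoiders so that [f] can reindex them. *)
have to_sig p (F : 'S_n -> R) :
    (\sum_(s in sortable_avoiders t n p) F s =
     \sum_(s : {s : 'S_n | s \in avoiders n p} | stack_sortable t (sval s)) F (sval s))%R.
  rewrite (eq_bigl (fun s => (s \in avoiders n p) && stack_sortable t s)).
    by rewrite big_sub_cond.
  by move=> s; rewrite !inE andbC.
rewrite !to_sig [RHS](reindex f) /=; last exact: onW_bij.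
apply: eq_big => s; have [st [fx dr]] := stats s; last by rewrite fx dr.
by apply/idP/idP => /st.
Qed.
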